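(* Let $B$ be a band, written as a semilattice $Y$ of rectangular bands $B_\alpha$, $\alpha\in Y$. Then $\operatorname{IG}(B)$ is a weakly abundant semigroup with the congruence condition.
   Context: A band is a semigroup all of whose elements are idempotent. Every band $B$ is a semilattice $Y$ of rectangular bands $B_\alpha$: $B=\bigcup_{\alpha\in Y}B_\alpha$ (disjoint union), each $B_\alpha$ is a rectangular band and $B_\alpha B_\beta\subseteq B_{\alpha\beta}$; the $B_\alpha$ are the $\mathcal D$-classes of $B$. A pair $(e,f)\in B\times B$ is basic if $\{e,f\}\cap\{ef,fe\}\neq\emptyset$. The free idempotent generated semigroup over $B$ is given by the presentation $\operatorname{IG}(B)=\langle \overline{B} : \overline{e}\,\overline{f}=\overline{ef},\ (e,f)\text{ a basic pair}\rangle$ (as a semigroup), where $\overline{B}=\{\overline{e}:e\in B\}$ is a set of symbols in bijection with $B$. For a semigroup $S$ with set of idempotents $E(S)$: $a\,\widetilde{\mathcal L}\,b$ iff for all $e\in E(S)$, $ae=a\Leftrightarrow be=b$; and $a\,\widetilde{\mathcal R}\,b$ iff for all $e\in E(S)$, $ea=a\Leftrightarrow eb=b$. $S$ is weakly abundant if each $\widetilde{\mathcal L}$-class and each $\widetilde{\mathcal R}$-class contains an idempotent. A weakly abundant semigroup satisfies the congruence condition if $\widetilde{\mathcal L}$ is a right congruence and $\widetilde{\mathcal R}$ is a left congruence. *)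

(* Defs.v *)
From HB Require Import structures.
From Stdlib Require Import Relation_Definitions.
From mathcomp Require Import all_boot.
From mathcomp Require Import boolp classical_sets.

Set Implicit Arguments.
Unset Strict Implicit.
Unset Printing Implicit Defensive.

Import Algebra.
Local Open Scope group_scope.
Local Open Scope quotient_scope.
Local Open Scope classical_set_scope.

Definition idem (S : semigroupType) (e : S) : Prop := e * e = e.

Definition band (S : semigroupType) : Prop := forall e : S, idem e.

Definition semilattice (Y : semigroupType) : Prop :=
  band Y /\ commutative (@mul Y).

(* A nonempty subset of S which, with the operation of S, is a rectangular band *)
Record rectangular_band (S : semigroupType) (A : set S) : Prop := {
  rect_nonempty : A !=set0;
  rect_mul : forall x y, A x -> A y -> A (x * y);
  rect_idem : forall x, A x -> idem x;
  rect_xyx : forall x y, A x -> A y -> x * y * x = x }.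

Record semilattice_of_rectangular_bands (B Y : semigroupType) (C : Y -> set B)
    : Prop := {
  slrb_semilattice : semilattice Y;
  slrb_cover : \bigcup_(a in [set: Y]) C a = [set: B];
  slrb_disjoint : trivIset [set: Y] C;
  slrb_rectangular : forall a, rectangular_band (C a);
  slrb_mul : forall a b x y, C a x -> C b y -> C (a * b) (x * y) }.

Section WeaklyAbundant.
Variable S : semigroupType.
Implicit Types a b c e : S.

Definition Ltilde : relation S := fun a b =>
  forall e, idem e -> (a * e = a <-> b * e = b).

Definition Rtilde : relation S := fun a b =>
  forall e, idem e -> (e * a = a <-> e * b = b).

Definition right_congruence (r : relation S) : Prop :=
  equivalence S r /\ forall a b c, r a b -> r (a * c) (b * c).

Definition left_congruence (r : relation S) : Prop :=
  equivalence S r /\ forall a b c, r a b -> r (c * a) (c * b).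

Definition weakly_abundant : Prop :=
  (forall a, exists2 e, idem e & Ltilde a e) /\
  (forall a, exists2 e, idem e & Rtilde a e).

Definition congruence_condition : Prop :=
  right_congruence Ltilde /\ left_congruence Rtilde.

End WeaklyAbundant.

(* The free semigroup on X: nonempty words under concatenation *)
Definition free_semigroup (X : choiceType) : Type :=
  {s : seq X | ~~ nilp s}.

Section FreeSemigroup.
Variable X : choiceType.
Implicit Types u v w : free_semigroup X.

HB.instance Definition _ := Choice.on (free_semigroup X).

Fact free_mul_subproof u v : ~~ nilp (sval u ++ sval v).
Proof. by case: u v => [[|x u] Hu] [v Hv]. Qed.

Definition free_mul u v : free_semigroup X :=
  exist (fun s => ~~ nilp s) (sval u ++ sval v) (free_mul_subproof u v).

Fact free_mulA : associative free_mul.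
Proof. by move=> u v w; apply: val_inj; rewrite /= catA. Qed.

HB.instance Definition _ := isSemigroup.Build (free_semigroup X) free_mulA.

Definition free_gen (x : X) : free_semigroup X :=
  exist (fun s => ~~ nilp s) [:: x] isT.

End FreeSemigroup.

Section QuotientByRelations.
Variables (S : semigroupType) (rho : relation S).

Inductive gen_congr : relation S :=
| gen_congr_in x y : rho x y -> gen_congr x y
| gen_congr_refl x : gen_congr x x
| gen_congr_sym x y : gen_congr x y -> gen_congr y x
| gen_congr_trans x y z : gen_congr x y -> gen_congr y z -> gen_congr x z
| gen_congr_mul x x' y y' :
    gen_congr x x' -> gen_congr y y' -> gen_congr (x * y) (x' * y').

Definition gen_congrb : rel S := fun x y => `[< gen_congr x y >].

Fact gen_congrb_refl : reflexive gen_congrb.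
Proof. by move=> x; apply/asboolP/gen_congr_refl. Qed.

Fact gen_congrb_sym : symmetric gen_congrb.
Proof.
by move=> x y; apply/asboolP/asboolP; apply: gen_congr_sym.
Qed.

Fact gen_congrb_trans : transitive gen_congrb.
Proof.
move=> y x z /asboolP xy /asboolP yz.
by apply/asboolP; apply: gen_congr_trans xy yz.
Qed.

Canonical gen_congr_equiv :=
  EquivRel gen_congrb gen_congrb_refl gen_congrb_sym gen_congrb_trans.

Definition quot_by : Type := {eq_quot gen_congr_equiv}.

HB.instance Definition _ := Choice.on quot_by.
HB.instance Definition _ := EqQuotient.on quot_by.

Definition quot_mul : quot_by -> quot_by -> quot_by := lift_op2 quot_by mul.

Lemma quot_piP (x y : S) : \pi_quot_by x = \pi_quot_by y <-> gen_congr x y.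
Proof.
split=> [/eqP|xy]; first by rewrite eqmodE => /asboolP.
by apply/eqP; rewrite eqmodE; apply/asboolP.
Qed.

Fact quot_piM : {morph \pi_quot_by : x y / x * y >-> quot_mul x y}.
Proof.
move=> x y; rewrite /quot_mul; unlock; apply/quot_piP.
by apply: gen_congr_mul; apply/quot_piP; rewrite reprK.
Qed.

Fact quot_mulA : associative quot_mul.
Proof.
by elim/quotW=> x; elim/quotW=> y; elim/quotW=> z; rewrite -!quot_piM mulgA.
Qed.

HB.instance Definition _ := isSemigroup.Build quot_by quot_mulA.

End QuotientByRelations.

Definition basic_pair (B : semigroupType) (e f : B) : Prop :=
  [set e; f] `&` [set e * f; f * e] !=set0.

(* The defining relations of IG(B), over the free semigroup on B *)
Inductive IG_rel (B : semigroupType) : relation (free_semigroup B) :=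
| IG_rel_basic e f : basic_pair e f ->
    IG_rel (free_gen e * free_gen f) (free_gen (e * f)).

Definition IG (B : semigroupType) : semigroupType := quot_by (@IG_rel B).

(* Main.v *)
(** For a word [w] over [B], call a prefix [u x] good when the D-class of [x]
    lies below those of all letters of [u]. The products in [B] of the good
    prefixes decrease in the R-order, and the R-class of the least one, [p],
    depends only on the element [a] of [IG B] that [w] represents. Since
    [eta p * a = a], the generator [eta p] is Rtilde-related to [a], once one
    knows that every idempotent of [IG B] is R-related to a generator.

    For the latter, let [w] represent an idempotent. Read a word as a machine
    acting on sequences over [Y], each letter [x] stripping the longest prefix
    whose terms all lie above the class of [x]. This action factors through
    [IG B], so [w] strips its own class sequence repeated [size w + 1] times,
    as the corresponding power of [w] does. By pigeonhole one letter strips a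
    whole copy, that is, it lies below all letters of [w]; and a word with a
    least letter represents an element R-related to a generator. *)

Require Import Defs.
From HB Require Import structures.
From Stdlib Require Import Relation_Definitions.
From mathcomp Require Import all_boot.
From mathcomp Require Import boolp classical_sets.

Set Implicit Arguments.
Unset Strict Implicit.
Unset Printing Implicit Defensive.

Import Algebra.
Local Open Scope group_scope.
Local Open Scope classical_set_scope.

(** * Left-right duality *)

Definition opposite (S : Type) : Type := S.

Section Opposite.
Variable S : semigroupType.

Definition opposite_mul (x y : opposite S) : opposite S := (y : S) * (x : S).

Fact opposite_mulA : associative opposite_mul.
Proof. by move=> x y z; rewrite /opposite_mul mulgA. Qed.

HB.instance Definition _ := Choice.on (opposite S).
HB.instance Definition _ := isSemigroup.Build (opposite S) opposite_mulA.

Lemma opposite_mulE (x y : opposite S) : x * y = (y : S) * (x : S) :> S.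
Proof. by []. Qed.

End Opposite.

(** The decomposition as a morphism with rectangular fibres, [c x] naming the D-class of [x]; this
    form passes to the opposite. *)
Record graded_band (B Y : semigroupType) (c : B -> Y) : Prop := {
  graded_idem : forall x : B, x * x = x;
  graded_semilattice : semilattice Y;
  graded_mul : {morph c : x y / x * y};
  graded_rect : forall x y, c x = c y -> x * y * x = x }.

(* A self-dual characterisation of IG(B), so that statements about right
   multiplication follow from those about left multiplication:
   [ev w a] reads "the word [w] represents [a]", and [pres_inv] says that a
   predicate on words invariant under the defining relations is a predicate on
   represented elements. *)
Record presents (B S : semigroupType) (eta : B -> S) (ev : seq B -> S -> Prop)
    : Prop := {
  pres_basic : forall e f, basic_pair e f -> eta e * eta f = eta (e * f);
  pres_nil : forall a, ~ ev [::] a;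
  pres_gen : forall x, ev [:: x] (eta x);
  pres_cat : forall u v a b, ev u a -> ev v b -> ev (u ++ v) (a * b);
  pres_word : forall a, exists w, ev w a;
  pres_fun : forall w a b, ev w a -> ev w b -> a = b;
  pres_inv : forall P : seq B -> Prop,
    (forall u e f v, basic_pair e f ->
       P (u ++ [:: e, f & v]) <-> P (u ++ (e * f) :: v)) ->
    forall w w' a, ev w a -> ev w' a -> P w -> P w' }.

Section BasicPairs.
Variable B : semigroupType.
Implicit Types e f : B.

Lemma basic_pairP e f :
  basic_pair e f <-> [\/ e * f = e, f * e = e, e * f = f | f * e = f].
Proof.
split=> [[g [[->|->] [E|E]]]|].
- exact: Or41.
- exact: Or42.
- exact: Or43.
- exact: Or44.
case=> E; [exists e | exists e | exists f | exists f]; split.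
all: by [left | right | left; rewrite E | right; rewrite E].
Qed.

Lemma basic_mul_l e f : e * f = e -> basic_pair e f.
Proof. by move=> E; apply/basic_pairP; apply: Or41. Qed.

Lemma basic_mul_r e f : e * f = f -> basic_pair e f.
Proof. by move=> E; apply/basic_pairP; apply: Or43. Qed.

Lemma basic_mul_rl e f : f * e = f -> basic_pair e f.
Proof. by move=> E; apply/basic_pairP; apply: Or44. Qed.

End BasicPairs.

Lemma basic_opposite (B : semigroupType) (e f : B) :
  @basic_pair (opposite B) e f -> basic_pair f e.
Proof.
by case/basic_pairP; rewrite opposite_mulE => E; apply/basic_pairP;
  [apply: Or43 | apply: Or44 | apply: Or41 | apply: Or42].
Qed.

Lemma graded_opposite (B Y : semigroupType) (c : B -> Y) :
  graded_band c -> @graded_band (opposite B) Y c.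
Proof.
move=> [idB slY cM rectB]; split=> // x y; last first.
  by move=> cxy; rewrite !opposite_mulE mulgA; apply: rectB.
by rewrite opposite_mulE cM; apply: (slY.2).
Qed.

Lemma presents_opposite (B S : semigroupType) (eta : B -> S) ev :
  presents eta ev ->
  @presents (opposite B) (opposite S) eta (fun w a => ev (rev w) a).
Proof.
move=> [etaM evN evG evC evW evF evI]; split=> //.
- by move=> e f /basic_opposite /etaM.
- by move=> u v a b ua vb; rewrite rev_cat; apply: evC.
- by move=> a; have [w wa] := evW a; exists (rev w); rewrite revK.
- by move=> w a b; apply: evF.
- move=> P PI w w' a wa w'a Pw; rewrite -[w']revK.
  apply: (evI (fun w => P (rev w))) wa w'a _; last by rewrite revK.
  move=> u e f v /basic_pairP ef; rewrite !rev_cat !rev_cons -!cats1 -!catA /=.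
  have /PI E : @basic_pair (opposite B) f e.
    by apply/basic_pairP; rewrite !opposite_mulE; case: ef => E;
      [apply: Or43 | apply: Or44 | apply: Or41 | apply: Or42].
  exact: E.
Qed.

Section RightHalf.
Variables (B Y S : semigroupType) (c : B -> Y).
Variables (eta : B -> S) (ev : seq B -> S -> Prop).
Hypotheses (cB : graded_band c) (evP : presents eta ev).

Let mulBB (x : B) : x * x = x := graded_idem cB x.
Let cM : {morph c : x y / x * y} := graded_mul cB.
Let mulYC : commutative (@mul Y) := (graded_semilattice cB).2.
Let mulYY (x : Y) : x * x = x := (graded_semilattice cB).1 x.
Let etaM := pres_basic evP.

(** * The order on the semilattice of D-classes *)

Definition below (x y : Y) : bool := x * y == x.

Lemma below_refl x : below x x.
Proof. by apply/eqP. Qed.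

Lemma below_trans : transitive below.
Proof. by move=> y x z /eqP xy /eqP yz; apply/eqP; rewrite -xy -mulgA yz. Qed.

Lemma below_mul x y z : below z (x * y) = below z x && below z y.
Proof.
apply/eqP/andP => [E|[/eqP zx /eqP zy]]; last by rewrite mulgA zx.
split; apply/eqP; rewrite -[in LHS]E -!mulgA.
- by rewrite (mulYC y) (mulgA x) mulYY E.
- by rewrite mulYY E.
Qed.

Lemma below_c x y : below (c x) (c y) -> c (x * y) = c x.
Proof. by move/eqP; rewrite cM. Qed.

Lemma below_cl x y : below (c x) (c y) -> c (y * x) = c x.
Proof. by rewrite cM mulYC => /eqP. Qed.

Lemma below_rect x y : below (c x) (c y) -> x * y * x = x.
Proof.
move/below_c => E; have := graded_rect cB (esym E).
by rewrite !mulgA mulBB.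
Qed.

Lemma basic_below e f : basic_pair e f -> below (c e) (c f) \/ below (c f) (c e).
Proof.
case/basic_pairP => /(congr1 c); rewrite cM => E;
  by [left; rewrite /below E | left; rewrite /below mulYC E
     | right; rewrite /below mulYC E | right; rewrite /below E].
Qed.

Lemma ev_total w : w != [::] -> exists a, ev w a.
Proof.
elim: w => // x [|y w] IH _; first by exists (eta x); apply: (pres_gen evP).
have [//|a wa] := IH; exists (eta x * a).
exact: (pres_cat evP (pres_gen evP x)).
Qed.

Lemma ev_cons x w a : ev w a -> ev (x :: w) (eta x * a).
Proof. exact: (pres_cat evP (pres_gen evP x)). Qed.

Lemma ev_ind (P : seq B -> S -> Prop) :
  (forall x, P [:: x] (eta x)) ->
  (forall x w a, ev w a -> P w a -> P (x :: w) (eta x * a)) ->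
  forall w a, ev w a -> P w a.
Proof.
move=> P1 PS; elim=> [|x w IH] a wa; first by case: (pres_nil evP wa).
have [E|/ev_total[b wb]] := eqVneq w [::].
  by rewrite E in wa *; rewrite (pres_fun evP wa (pres_gen evP x)).
rewrite (pres_fun evP wa (ev_cons x wb)).
by apply: PS; last exact: IH.
Qed.

Lemma eta_idem x : eta x * eta x = eta x.
Proof. by rewrite etaM ?mulBB //; apply: basic_mul_l. Qed.

(** [(x, p)] need not be basic, but [eta p = eta (p * x) * eta p] and [(x, p * x)] is basic. *)
Lemma eta_swallow x p : below (c p) (c x) ->
  eta (x * p) * (eta x * eta p) = eta x * eta p.
Proof.
move=> px.
have <- : eta (p * x) * eta p = eta p.
  rewrite etaM ?(below_rect px) //.
  by apply: basic_mul_r; exact: below_rect.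
have Ex : eta x * eta (p * x) = eta (x * (p * x)).
  by apply: etaM; apply: basic_mul_rl; rewrite -mulgA mulBB.
rewrite (mulgA (eta x)) Ex mulgA etaM; last first.
  by apply: basic_mul_r; rewrite !mulgA -(mulgA (x * p)) mulBB.
by congr (eta _ * _); rewrite !mulgA -(mulgA (x * p)) mulBB.
Qed.

Lemma eta_swallow_inv x p : below (c p) (c x) ->
  exists z, eta x * eta p * z = eta (x * p).
Proof.
(* The first factor turns the product into [eta (x * p * x)], the second absorbs that. *)
move=> px; exists (eta (p * x) * eta (x * p)).
have Ep : eta p * eta (p * x) = eta (p * x).
  by rewrite etaM ?mulgA ?mulBB //; apply: basic_mul_r; rewrite mulgA mulBB.
rewrite mulgA -(mulgA (eta x)) Ep etaM; last first.
  by apply: basic_mul_rl; rewrite -mulgA mulBB.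
have E : x * (p * x) * (x * p) = x * p.
  by rewrite !mulgA -(mulgA (x * p)) mulBB -mulgA mulBB.
by rewrite etaM ?E //; apply: basic_mul_r.
Qed.

(* [good w q]: [q] is the product of a prefix of [w] whose last letter is below
   all letters of the prefix. *)
Fixpoint good (w : seq B) (q : B) : Prop :=
  if w is x :: w' then
    q = x \/ exists p, [/\ good w' p, below (c p) (c x) & q = x * p]
  else False.

(** Some good product lies R-below [g]: unlike the set of good products, this is invariant under the
    defining relations. *)
Definition fixes (g : B) (w : seq B) : Prop := exists2 q, good w q & g * q = q.

Lemma fixes_mono x w w' : (forall g, fixes g w -> fixes g w') ->
  forall g, fixes g (x :: w) -> fixes g (x :: w').
Proof.
move=> ww' g [q /= [->|[p [wp px ->]]] gq]; first by exists x => //; left.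
(* The idempotent [p] fixes itself, so the hypothesis applies with [p] as [g]. *)
have [p' w'p' pp'] : fixes p w' by apply: ww'; exists p.
exists (x * p').
  right; exists p'; split=> //; apply: below_trans px.
  by apply/eqP; rewrite mulYC -cM pp'.
by rewrite -pp' !mulgA -(mulgA g) gq.
Qed.

Lemma fixes_basic_head e f v g : basic_pair e f ->
  fixes g [:: e, f & v] <-> fixes g (e * f :: v).
Proof.
move=> ef; have efe := basic_below ef.
split=> [] [q].
- case=> [->|[p [/= [->|[r [vr rf ->]]] pe ->]]] gq.
  + exists (e * f); first by left.
    by rewrite mulgA gq.
  + by exists (e * f); first by left.
  + exists (e * f * r); last by rewrite -mulgA.
    right; exists r; split=> //; rewrite cM below_mul rf andbT.
    by rewrite below_cl in pe.
- case=> [->|[p [vp pef ->]]] gq.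
  + case: efe => [ef'|fe]; last first.
      by exists (e * f) => //; right; exists f; split=> //; left.
    exists e; first by left.
    by have := below_rect ef' => E; rewrite -[in LHS]E mulgA gq.
  + move: pef; rewrite cM below_mul => /andP[pe pf].
    exists (e * f * p) => //; right; exists (f * p).
    by rewrite /= below_cl // mulgA; split=> //; right; exists p.
Qed.

Lemma fixes_basic u e f v g : basic_pair e f ->
  fixes g (u ++ [:: e, f & v]) <-> fixes g (u ++ e * f :: v).
Proof.
move=> ef; elim: u g => [|x u IH] g; first exact: fixes_basic_head.
by split; apply: fixes_mono => h /IH.
Qed.

Lemma fixes_ev g w w' a : ev w a -> ev w' a -> fixes g w -> fixes g w'.
Proof.
by apply: (pres_inv evP) => u e f v ef; apply: fixes_basic.
Qed.

Lemma good_absorb w p a : ev w a -> good w p -> eta p * a = a.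
Proof.
move=> wa; elim/ev_ind: wa p => {w a} [x|x w a wa IH] p /=.
  by case=> [->|[q []] //]; exact: eta_idem.
case=> [->|[q [wq qx ->]]]; first by rewrite mulgA eta_idem.
by rewrite -(IH q) // !mulgA -(mulgA _ (eta x)) eta_swallow.
Qed.

(** [[:: p; q]] and [[:: q]] represent the same element, and [q] is the only good product of the
    latter. *)
Lemma eta_mul_fix p q : eta p * eta q = eta q -> p * q = q.
Proof.
move=> E; have pq : ev [:: p; q] (eta q).
  by rewrite -E; apply/ev_cons/(pres_gen evP).
have [r /= [->|[? []] //]] : fixes p [:: q].
  apply: fixes_ev pq (pres_gen evP q) _.
  by exists p => //; left.
by [].
Qed.

Definition least_good (w : seq B) (p : B) : Prop :=
  good w p /\ forall g, fixes g w -> g * p = p.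

(** Every good product of [w] has class above that of [p], so if any of them extends through [x],
    then [p] does. *)
Lemma least_good_cons x w p : least_good w p ->
  least_good (x :: w) (if below (c p) (c x) then x * p else x).
Proof.
move=> [wp lep]; split=> [|g [q /= [->|[r [wr rx ->]]] gq]].
- by case: ifP => px; [right; exists p | left].
- by case: ifP => // _; rewrite mulgA gq.
- have rp : r * p = p by apply: lep; exists r.
  have -> : below (c p) (c x).
    by apply: below_trans rx; apply/eqP; rewrite mulYC -cM rp.
  by rewrite -rp !mulgA -(mulgA g) gq.
Qed.

Lemma least_good_ex w a : ev w a -> exists p, least_good w p.
Proof.
elim/ev_ind=> {w a} [x|x w a _ [p wp]]; last first.
  by eexists; apply: least_good_cons wp.
exists x; split; first by left.
by move=> g [q /= [->|[? []] //]].
Qed.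

(** For idempotents this is R-equivalence, in the form that [Rtilde] tests. *)
Definition same_left_units (a b : S) : Prop := forall s, a * s = s <-> b * s = s.

(** * The stripping action on sequences over [Y] *)

Definition strip (al : Y) (s : seq Y) : seq Y :=
  drop (find (predC (below al)) s) s.

Definition stripw (w : seq B) (s : seq Y) : seq Y :=
  foldl (fun s x => strip (c x) s) s w.

Lemma strip_cons al be s :
  strip al (be :: s) = if below al be then strip al s else be :: s.
Proof. by rewrite /strip /=; case: (below al be). Qed.

Lemma strip_below_l al be s : below al be -> strip be (strip al s) = strip al s.
Proof.
move=> ab; elim: s => // ga s IH; rewrite strip_cons.
case: ifP => // ag; rewrite strip_cons; case: ifP => // bg.
by rewrite (below_trans ab bg) in ag.
Qed.

Lemma strip_below_r al be s : below be al -> strip be (strip al s) = strip be s.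
Proof.
move=> ba; elim: s => // ga s IH; rewrite !strip_cons.
case: ifP => [ag|_]; last by rewrite strip_cons.
by rewrite (below_trans ba ag).
Qed.

(** The classes of a basic pair are comparable, and stripping by both amounts to stripping by the
    smaller, the class of the product. *)
Lemma stripw_basic u e f v s : basic_pair e f ->
  stripw (u ++ [:: e, f & v]) s = stripw (u ++ e * f :: v) s.
Proof.
rewrite /stripw !foldl_cat /= => /basic_below[] ef; congr (foldl _ _ _).
- by rewrite strip_below_l // below_c.
- by rewrite strip_below_r // below_cl.
Qed.

Lemma stripw_ev w w' a s : ev w a -> ev w' a -> stripw w s = [::] ->
  stripw w' s = [::].
Proof.
apply: (pres_inv evP (P := fun w => stripw w s = [::])) => u e f v ef.
by rewrite stripw_basic.
Qed.

(** Each letter strips at least its own class; the offset [n] records what was stripped in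
    advance. *)
Lemma stripw_self w n : stripw w (drop n (map c w)) = [::].
Proof.
elim: w n => [|x w IH] [|n] //=; last by rewrite /strip drop_drop.
by rewrite strip_cons below_refl -[map c w]drop0 /strip drop_drop.
Qed.

Lemma strip_stuck al t s r : has (predC (below al)) s ->
  exists t', strip al (t ++ s ++ r) = t' ++ r.
Proof.
move=> hs; have hts : has (predC (below al)) (t ++ s) by rewrite has_cat hs orbT.
exists (drop (find (predC (below al)) (t ++ s)) (t ++ s)).
by rewrite /strip catA find_cat hts drop_cat -has_find hts.
Qed.

(** Every copy of [s] blocks every letter, so each letter uses up at most one copy; [t] is the
    remnant of a partly stripped one. *)
Lemma stripw_stuck v s t m :
  all (fun x => has (predC (below (c x))) s) v ->
  exists t', stripw v (t ++ flatten (nseq (size v + m) s)) =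
             t' ++ flatten (nseq m s).
Proof.
elim: v t => [|x v IH] t /=; first by exists t.
case/andP=> /strip_stuck hx /IH hv.
by have [t' ->] := hx t (flatten (nseq (size v + m) s)).
Qed.

Lemma ev_power w a k : idem a -> ev w a -> ev (flatten (nseq k.+1 w)) a.
Proof.
move=> aa wa; elim: k => [|k IH] /=; first by rewrite cats0.
by rewrite -aa; apply: (pres_cat evP wa IH).
Qed.

Lemma idem_least_letter w a : idem a -> ev w a ->
  exists2 x, x \in w & all (fun y => below (c x) (c y)) w.
Proof.
move=> aa wa; apply/hasP/negPn/negP; rewrite -all_predC => stuck.
have /(stripw_stuck [::] 1)[t] :
    all (fun x => has (predC (below (c x))) (map c w)) w.
  by apply: sub_all stuck => x /=; rewrite has_map -has_predC.
rewrite /= cats0 addn1 => E.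
(* With one copy more than [w] has letters, [stripw w] leaves a copy of [map c w], yet it must leave
   nothing. *)
have := stripw_self (flatten (nseq (size w).+1 w)) 0.
rewrite drop0 map_flatten map_nseq.
move/(stripw_ev (ev_power (size w) aa wa) wa); rewrite E.
by case: (w) wa => [/(pres_nil evP)|? ? _]; last case: (t).
Qed.

(** * R-classes of idempotents *)

Lemma rdiv_least w a x : ev w a -> all (fun y => below (c x) (c y)) w ->
  exists z q, a * z = eta q /\ c q = c x.
Proof.
elim/ev_ind=> {w a} [y|y w a wa IH] /=.
  rewrite andbT => xy; exists (eta (y * x)), (y * x).
  rewrite etaM ?mulgA ?mulBB ?below_cl //.
  by apply: basic_mul_r; rewrite mulgA mulBB.
case/andP=> xy /IH[z [q [azq cq]]].
have qy : below (c q) (c y) by rewrite cq.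
have [z' E] := eta_swallow_inv qy.
exists (z * z'), (y * q); rewrite below_cl //; split=> //.
by rewrite -!mulgA (mulgA a) azq mulgA.
Qed.

Lemma good_least w x : x \in w -> all (fun y => below (c x) (c y)) w ->
  exists2 p, good w p & c p = c x.
Proof.
elim: w => //= y w IH; rewrite inE => /predU1P[->|xw] /andP[xy lew].
  by exists y => //; left.
have [p wp cp] := IH xw lew.
exists (y * p); first by right; exists p; rewrite cp.
by rewrite below_cl cp.
Qed.

(** [a] lies R-below [eta p] for a good [p] and R-above some [eta q], with [p] and [q] in the class
    of the least letter; [p * q = q] then makes them R-related. *)
Lemma idem_same_left_units a : idem a -> exists q, same_left_units a (eta q).
Proof.
move=> aa; have [w wa] := pres_word evP a.
have [x xw lex] := idem_least_letter aa wa.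
have [p /(good_absorb wa) pa cp] := good_least xw lex.
have [z [q [azq cq]]] := rdiv_least wa lex.
have aq : a * eta q = eta q by rewrite -azq mulgA aa.
have pq : p * q = q by apply: eta_mul_fix; rewrite -azq mulgA pa.
have qp : q * p = p by rewrite -{1}pq; apply: (graded_rect cB); rewrite cp cq.
have qa : eta q * a = a.
  have E : eta q * eta p = eta p by rewrite etaM ?qp //; apply: basic_mul_r.
  by rewrite -[in LHS]pa mulgA E pa.
exists q => s; split=> E; first by rewrite -E mulgA qa.
by rewrite -E mulgA aq.
Qed.

(** * [Rtilde] through least good products *)

Lemma Rtilde_least_good w a p : ev w a -> least_good w p -> Rtilde a (eta p).
Proof.
move=> wa [wp lep] e /idem_same_left_units[g eg].
have pa := good_absorb wa wp.
suff [ga gp] : (eta g * a = a -> eta g * eta p = eta p) /\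
    (eta g * eta p = eta p -> eta g * a = a).
  by split=> /eg => [/ga|/gp] /eg.
split=> E; last by rewrite -pa mulgA E.
have gp : g * p = p.
  (* [g :: w] also represents [a], and [g] is a good product of it. *)
  apply: lep; apply: (@fixes_ev _ (g :: w) _ a) => //.
    by rewrite -E; apply: ev_cons.
  by exists g => //; left.
by rewrite etaM ?gp //; apply: basic_mul_r.
Qed.

Lemma Rtilde_equivalence : equivalence S (@Rtilde S).
Proof.
split=> [a e _|a b d ab bd e ie|a b ab e ie]; first by [].
- exact: iff_trans (ab e ie) (bd e ie).
- exact: iff_sym (ab e ie).
Qed.

Lemma Rtilde_eta p q : p * q = q -> q * p = p -> Rtilde (eta p) (eta q).
Proof.
move=> pq qp e _.
have Epq : eta p * eta q = eta q by rewrite etaM ?pq //; apply: basic_mul_r.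
have Eqp : eta q * eta p = eta p by rewrite etaM ?qp //; apply: basic_mul_r.
by split=> E; [rewrite -Epq mulgA E | rewrite -Eqp mulgA E].
Qed.

Lemma Rtilde_etaP p q : Rtilde (eta p) (eta q) -> p * q = q /\ q * p = p.
Proof.
move=> pq; split; apply: eta_mul_fix; apply/pq; exact: eta_idem.
Qed.

Lemma Rtilde_eta_mul a b x : Rtilde a b -> Rtilde (eta x * a) (eta x * b).
Proof.
case: Rtilde_equivalence => _ tr sy ab.
have [v va] := pres_word evP a; have [w wb] := pres_word evP b.
have [p vp] := least_good_ex va; have [q wq] := least_good_ex wb.
have ap := Rtilde_least_good va vp; have bq := Rtilde_least_good wb wq.
have [pq qp] := Rtilde_etaP (tr _ _ _ (tr _ _ _ (sy _ _ ap) ab) bq).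
have xap := Rtilde_least_good (ev_cons x va) (least_good_cons x vp).
have xbq := Rtilde_least_good (ev_cons x wb) (least_good_cons x wq).
apply: (tr _ _ _ xap); apply: (tr _ _ _ _ (sy _ _ xbq)).
(* As [p] and [q] share a D-class, [least_good_cons] takes the same branch for both. *)
have <- : c p = c q by rewrite -pq cM mulYC -cM qp.
case: ifP => px; apply: Rtilde_eta; rewrite ?mulBB //.
- by rewrite -[in LHS]pq !mulgA -(mulgA _ x p) mulBB -mulgA pq.
- by rewrite -[in LHS]qp !mulgA -(mulgA _ x q) mulBB -mulgA qp.
Qed.

Lemma Rtilde_idem (a : S) : exists2 e, idem e & Rtilde a e.
Proof.
have [w wa] := pres_word evP a; have [p wp] := least_good_ex wa.
by exists (eta p); [exact: eta_idem | exact: Rtilde_least_good wa wp].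
Qed.

Lemma Rtilde_left_congruence : left_congruence (@Rtilde S).
Proof.
split=> [|a b d ab]; first exact: Rtilde_equivalence.
have [w wd] := pres_word evP d.
elim/ev_ind: wd => {w d} [x|x w d _ IH]; first exact: Rtilde_eta_mul.
by rewrite -!mulgA; apply: Rtilde_eta_mul.
Qed.

End RightHalf.

(** * Words representing elements of [IG B] *)

Section Presentation.
Variable B : semigroupType.

Let piIG (u : free_semigroup B) : IG B := \pi_(quot_by (@IG_rel B))%qT u.

Definition IG_gen (x : B) : IG B := piIG (free_gen x).

Definition IG_word (w : seq B) (a : IG B) : Prop :=
  exists2 u : free_semigroup B, sval u = w & piIG u = a.

(** The context [l], [r] lets the product case change one factor at a time. *)
Lemma gen_congr_invariant (P : seq B -> Prop) :
  (forall u e f v, basic_pair e f ->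
     P (u ++ [:: e, f & v]) <-> P (u ++ (e * f) :: v)) ->
  forall u v : free_semigroup B, gen_congr (@IG_rel B) u v ->
  forall l r, P (l ++ sval u ++ r) <-> P (l ++ sval v ++ r).
Proof.
move=> PI u v; elim=> {u v} [_ _ [e f ef]|//|u v _ IH|u v w _ IH1 _ IH2|
    u u' v v' _ IHu _ IHv] l r.
- exact: PI.
- exact: iff_sym (IH l r).
- exact: iff_trans (IH1 l r) (IH2 l r).
- rewrite /= -!catA; apply: iff_trans (IHu _ _) _.
  by rewrite !(catA l); exact: IHv.
Qed.

Lemma IG_presents : presents IG_gen IG_word.
Proof.
have piM u v : piIG (u * v) = piIG u * piIG v by exact: quot_piM.
split.
- move=> e f ef; rewrite /IG_gen -piM.
  by apply/quot_piP/gen_congr_in.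
- by move=> a [[[|x u] nu]].
- by move=> x; exists (free_gen x).
- move=> u v a b [u' <- <-] [v' <- <-]; exists (u' * v') => //.
- by elim/quotW=> u; exists (sval u), u.
- by move=> w a b [u uw <-] [v vw <-]; congr piIG; apply: val_inj; rewrite /= uw.
- move=> P PI w w' a [u <- ua] [v <- va].
  have /quot_piP uv : piIG u = piIG v by rewrite ua.
  by have := gen_congr_invariant PI uv [::] [::]; rewrite !cats0 => [[]].
Qed.

End Presentation.

(** * From the decomposition to the theorem *)

Lemma rectangular_graded (B Y : semigroupType) (C : Y -> set B) :
  band B -> semilattice_of_rectangular_bands C ->
  exists c : B -> Y, graded_band c.
Proof.
move=> hB [slY cov dis rect mulC].
have classP x : {a | C a x}.
  apply: cid; have : [set: B] x := I.
  by rewrite -cov => -[a _ Cx]; exists a.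
have classE a x : C a x -> sval (classP x) = a.
  move=> Cx; apply: (dis _ _ I I); exists x.
  by split=> //; exact: (svalP (classP x)).
exists (fun x => sval (classP x)); split=> //.
  move=> x y; apply: classE.
  exact: mulC (svalP (classP x)) (svalP (classP y)).
move=> x y xy; apply: (rect_xyx (rect (sval (classP x)))).
  exact: svalP (classP x).
by rewrite xy; exact: svalP (classP y).
Qed.

Theorem theorem5p13 (B : semigroupType) (Y : semigroupType) (C : Y -> set B)
    (hB : band B) (hC : semilattice_of_rectangular_bands C) :
  weakly_abundant (IG B) /\ congruence_condition (IG B).
Proof.
have [c cB] := rectangular_graded hB hC.
have evP := IG_presents B.
have coB := graded_opposite cB; have evoP := presents_opposite evP.
split; split.
(* By conversion, [Ltilde] is [Rtilde] of the opposite semigroup. *)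
- exact: (Rtilde_idem coB evoP).
- exact: (Rtilde_idem cB evP).
- exact: (Rtilde_left_congruence coB evoP).
- exact: (Rtilde_left_congruence cB evP).
Qed.
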